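(* Let $G$ be an embedded graph and $e$ any edge of $G$. Then \[ P(G;\lambda)=P(G^{\delta(e)};\lambda)-P(G^{\delta\tau(e)};\lambda)=P(G^{\delta(e)};\lambda)+P(G^{\delta\tau\delta(e)};\lambda). \]
   Context: An embedded graph is a graph cellularly embedded in a closed (possibly non-orientable) surface, up to homeomorphism; equivalently a ribbon graph. It may be encoded by an arrow presentation: one circle per vertex carrying disjoint arrows, each edge label appearing on exactly two arrows (the two attaching arcs of that edge, oriented consistently with an orientation of the edge disc); presentations are equivalent up to reversing both arrows of a label and relabelling. For an edge $e$: $G^{\tau(e)}$ (half-twist / partial Petrial) is obtained by reversing exactly one of the two arrows labelled $e$. $G^{\delta(e)}$ (partial dual) is obtained as follows: if $A,B$ are the two arrows labelled $e$, draw a segment with an arrow from the head of $A$ to the tail of $B$ and a segment with an arrow from the head of $B$ to the tail of $A$, label both $e$, and delete $A$ and $B$ together with the arcs containing them, so the new segments become arcs of the new circles. Composite operations act right-to-left: $G^{\delta\tau(e)}:=(G^{\tau(e)})^{\delta(e)}$ and $G^{\delta\tau\delta(e)}:=((G^{\delta(e)})^{\tau(e)})^{\delta(e)}$. Penrose polynomial: the medial graph $G_m$ has a degree-4 vertex $v_e$ on each edge $e$ of $G$, with edges following the face boundaries of $G$ (an isolated vertex of $G$ contributes a vertex-free closed curve); its canonical checkerboard colouring colours a face black if it contains a vertex of $G$, white otherwise. At $v_e$, the white split pairs consecutive half-edges bounding white corners, the black split pairs those bounding black corners, and the crossing pairs opposite half-edges. A state $s$ chooses a vertex state at each vertex; $c(s)$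 = number of resulting closed curves, $cr(s)$ = number of crossings. Penrose states are states with no black split, and $P(G;\lambda)=\sum_{s\text{ Penrose}}(-1)^{cr(s)}\lambda^{c(s)}$. *)

(* Defs.v *)
From HB Require Import structures.
From mathcomp Require Import all_boot all_order all_algebra.

Set Implicit Arguments.
Unset Strict Implicit.
Unset Printing Implicit Defensive.

Import GRing.Theory.
Local Open Scope ring_scope.

(* [(e, a)] is one of the two arrows labelled [e]; [((e, a), true)] is its head
   and [((e, a), false)] its tail. *)
Definition arrow (E : Type) := (E * bool)%type.
Definition arrow_end (E : Type) := (arrow E * bool)%type.

Definition arrow_of (E : Type) (x : arrow_end E) : arrow E := x.1.
Definition label_of (E : Type) (x : arrow_end E) : E := x.1.1.

(* An arrow presentation with label set [E].  Removing the arrows from the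
   circles leaves a set of arcs, each joining two distinct arrow ends, together
   with [nblank] circles carrying no arrow (the isolated vertices); [arc x] is
   the other extremity of the arc that leaves from [x].  The circles carrying
   arrows are recovered by following alternately arrows and arcs, see
   [ncircles]. *)
Record arrow_presentation (E : finType) := ArrowPresentation {
  arc : arrow_end E -> arrow_end E;
  arcK : involutive arc;
  arc_neq : forall x, arc x != x;
  nblank : nat
}.

Section Presentations.
Variable E : finType.
Implicit Types (e : E) (x y : arrow_end E) (G : arrow_presentation E).

Definition opposite_end x : arrow_end E := (x.1, ~~ x.2).

Definition ncircles G : nat :=
  (n_comp [rel x y | (y == arc G x) || (y == opposite_end x)] predT
   + nblank G)%N.

(* Replaces the arrows of [G] without changing the rest of the circles: [p x]
   is the end of an old arrow at the point where the end [x] of a new arrow is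
   placed. *)
Section Replace.
Variables (p q : arrow_end E -> arrow_end E).
Hypotheses (pK : cancel p q) (qK : cancel q p).

Lemma replace_arcK G : involutive (fun x => q (arc G (p x))).
Proof. by move=> x; rewrite qK arcK pK. Qed.

Lemma replace_arc_neq G x : q (arc G (p x)) != x.
Proof. by rewrite -(inj_eq (can_inj pK)) qK arc_neq. Qed.

Definition replace_arrows G : arrow_presentation E :=
  ArrowPresentation (replace_arcK G) (replace_arc_neq G) (nblank G).
End Replace.

(* Reverses the arrow [(e, a)] only. *)
Definition tau_place e (a : bool) x : arrow_end E :=
  if arrow_of x == (e, a) then opposite_end x else x.

Lemma tau_placeK e a : involutive (tau_place e a).
Proof.
move=> [[f b] h]; rewrite /tau_place /arrow_of /=.
by case H: ((f, b) == (e, a)); rewrite /= H // /opposite_end negbK.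
Qed.

Definition half_twist_at e (a : bool) G :=
  replace_arrows (tau_placeK e a) (tau_placeK e a) G.

(* Which of the two arrows is reversed is immaterial, see
   [half_twist_equivalent]. *)
Definition half_twist e G := half_twist_at e true G.

(* The new arrow [(e, a)] goes from the head of the old arrow [(e, a)] to the
   tail of the old arrow [(e, ~~ a)]. *)
Definition delta_place e x : arrow_end E :=
  let: ((f, a), h) := x in
  if f == e then (if h then ((f, ~~ a), false) else ((f, a), true)) else x.

Definition delta_unplace e x : arrow_end E :=
  let: ((f, a), h) := x in
  if f == e then (if h then ((f, a), false) else ((f, ~~ a), true)) else x.

Lemma delta_placeK e : cancel (delta_place e) (delta_unplace e).
Proof.
by move=> [[f a] h] /=; case: ifP => H; case: h => /=; rewrite H ?negbK.
Qed.

Lemma delta_unplaceK e : cancel (delta_unplace e) (delta_place e).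
Proof.
by move=> [[f a] h] /=; case: ifP => H; case: h => /=; rewrite H ?negbK.
Qed.

Definition partial_dual e G :=
  replace_arrows (delta_placeK e) (delta_unplaceK e) G.

(* The medial graph.  The edges of the medial graph follow the face boundaries
   from one edge of the graph to the next one around a vertex, so they are the
   arcs of the presentation; accordingly the four half-edges at the medial
   vertex of [e] are the four ends of the arrows labelled [e], and the blank
   circles are the vertex-free closed curves.  The cyclic order of the
   half-edges is the order of the arrow ends on the boundary of the edge disc,
   which goes along an arrow from its tail to its head, then along a side of
   the edge to the tail of the other arrow. *)
Definition medial_next x : arrow_end E :=
  let: ((e, a), h) := x in if h then ((e, ~~ a), false) else ((e, a), true).

Definition medial_prev x : arrow_end E :=
  let: ((e, a), h) := x in if h then ((e, a), false) else ((e, ~~ a), true).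

Lemma medial_nextK : cancel medial_next medial_prev.
Proof. by move=> [[e a] []] /=; rewrite ?negbK. Qed.

(* The corner between [x] and [medial_next x] lies in a face containing a vertex
   when it is bounded by an arrow, i.e., by an arc where the edge disc meets a
   vertex disc; otherwise it is bounded by a side of the edge, along a face. *)
Definition black_corner x := arrow_of (medial_next x) == arrow_of x.

Lemma black_cornerE x : black_corner x = ~~ x.2.
Proof.
case: x => [[e a] []]; rewrite /black_corner /arrow_of /= ?eqxx //.
by rewrite xpair_eqE eqxx; case: a.
Qed.

End Presentations.

Inductive vertex_state := WhiteSplit | BlackSplit | Crossing.

Definition vertex_state_to_ord (t : vertex_state) : 'I_3 :=
  match t with
  | WhiteSplit => inord 0
  | BlackSplit => inord 1
  | Crossing => inord 2
  end.

Definition vertex_state_of_ord (i : 'I_3) : vertex_state :=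
  match val i with 0%N => WhiteSplit | 1%N => BlackSplit | _ => Crossing end.

Lemma vertex_state_to_ordK : cancel vertex_state_to_ord vertex_state_of_ord.
Proof. by case; rewrite /vertex_state_of_ord /= inordK. Qed.

HB.instance Definition _ :=
  Finite.copy vertex_state (can_type vertex_state_to_ordK).

Section Penrose.
Variable E : finType.
Implicit Types (x y : arrow_end E) (G : arrow_presentation E).

Definition paired_with (t : vertex_state) x : arrow_end E :=
  match t with
  | WhiteSplit => if black_corner x then medial_prev x else medial_next x
  | BlackSplit => if black_corner x then medial_next x else medial_prev x
  | Crossing => medial_next (medial_next x)
  end.

Definition state := {ffun E -> vertex_state}.

Definition ncurves G (s : state) : nat :=
  (n_comp [rel x y | (y == arc G x) || (y == paired_with (s (label_of x)) x)]
     predT + nblank G)%N.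

Definition ncrossings (s : state) : nat := #|[set e | s e == Crossing]|.

Definition penrose_state (s : state) : bool := [forall e, s e != BlackSplit].

(* The indeterminate ['X] is the variable lambda. *)
Definition penrose G : {poly int} :=
  \sum_(s : state | penrose_state s) (-1) ^+ ncrossings s * 'X^(ncurves G s).

Lemma ncurves_black G : ncurves G [ffun=> BlackSplit] = ncircles G.
Proof.
congr addn; apply: eq_n_comp; apply: eq_connect => x y /=.
rewrite ffunE; congr orb; congr (y == _).
by rewrite /paired_with black_cornerE; case: x => [[e a] []].
Qed.

End Penrose.

(* Relabels the arrow ends, exchanges the two arrows labelled [e] when [c e],
   and reverses both of them when [r e]. *)
Definition relabel (E F : finType) (sigma : E -> F) (c r : E -> bool)
    (x : arrow_end E) : arrow_end F :=
  let: ((e, a), h) := x in ((sigma e, a (+) c e), h (+) r e).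

Definition equivalent (E F : finType) (sigma : E -> F)
    (G : arrow_presentation E) (H : arrow_presentation F) : Prop :=
  bijective sigma /\ nblank G = nblank H /\
  exists c r : E -> bool,
    forall x, relabel sigma c r (arc G x) = arc H (relabel sigma c r x).

Section Invariance.
Variables (E F : finType) (sigma : E -> F).

Lemma relabel_bij c r : bijective sigma -> bijective (relabel sigma c r).
Proof.
case=> si sK siK.
exists (fun x : arrow_end F =>
  ((si x.1.1, x.1.2 (+) c (si x.1.1)), x.2 (+) r (si x.1.1))).
  by move=> [[e a] h] /=; rewrite sK !addbK.
by move=> [[e a] h] /=; rewrite siK !addbK.
Qed.

Lemma relabel_paired c r t x :
  relabel sigma c r (paired_with t x) = paired_with t (relabel sigma c r x).
Proof.
case: t; rewrite /paired_with ?black_cornerE; case: x => [[e a] h] /=;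
by case: h => /=; case Hr: (r e); rewrite /= ?Hr ?negbK ?addNb ?negbK.
Qed.

End Invariance.

Lemma n_comp_bij (S T : finType) (f : S -> T) (u : rel S) (v : rel T) :
    bijective f -> (forall x y, v (f x) (f y) = u x y) ->
    symmetric u -> symmetric v ->
  n_comp u predT = n_comp v predT.
Proof.
move=> [g fK gK] fe su sv.
have su' := sym_connect_sym su; have sv' := sym_connect_sym sv.
have cl : closed v (predT : {pred T}) by [].
have adj : rel_adjunction f v u (predT : {pred T}).
  apply: strict_adjunction => //; first exact: can_inj fK.
  by apply/subsetP=> y _; rewrite -[y]gK; apply: codom_f.
by rewrite (adjunction_n_comp f sv' su' cl adj); apply: eq_n_comp_r.
Qed.

Section Curves.
Variables (E : finType) (G : arrow_presentation E).

Lemma label_paired t (x : arrow_end E) : label_of (paired_with t x) = label_of x.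
Proof. by case: x t => [[e a] []] [] //=; case: ifP. Qed.

Lemma paired_withK t : involutive (@paired_with E t).
Proof.
move=> x; case: t; rewrite /paired_with ?black_cornerE;
by case: x => [[e a] []]; rewrite /= ?black_cornerE /= ?negbK.
Qed.

Lemma curve_sym (s : state E) : symmetric
  [rel x y | (y == arc G x) || (y == paired_with (s (label_of x)) x)].
Proof.
move=> x y /=; congr orb; first by rewrite -(inv_eq (@arcK _ G)) eq_sym.
by apply/eqP/eqP=> ->; rewrite label_paired paired_withK.
Qed.
End Curves.

Lemma penrose_equivalent (E F : finType) (sigma : E -> F) G H :
  equivalent sigma G H -> penrose G = penrose H.
Proof.
case=> [bs [eqb [c [r Hcr]]]].
have bf := relabel_bij c r bs.
have injf := bij_inj bf; have [si sK siK] := bs.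
pose up (s : state E) : state F := [ffun f => s (si f)].
pose dn (s : state F) : state E := [ffun e => s (sigma e)].
have upK : cancel up dn by move=> s; apply/ffunP=> e; rewrite !ffunE sK.
have dnK : cancel dn up by move=> s; apply/ffunP=> e; rewrite !ffunE siK.
rewrite /penrose [RHS](reindex up) /=; last first.
  by exists dn => s _; [apply: upK | apply: dnK].
apply: eq_big => [s|s _].
  apply/forallP/forallP => Hs e; last by have := Hs (sigma e); rewrite ffunE sK.
  by rewrite ffunE.
congr (_ ^+ _ * 'X^_).
  rewrite /ncrossings -(card_imset _ (bij_inj bs)); apply: eq_card => f.
  rewrite !inE ffunE; apply/imsetP/idP => [[e]|He].
    by rewrite inE => He ->; rewrite sK.
  by exists (si f); rewrite ?inE ?siK.
congr addn => //; apply: n_comp_bij bf _ (curve_sym _ _) (curve_sym _ _).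
move=> x y /=; rewrite -Hcr (inj_eq injf); congr orb.
rewrite (_ : up s _ = s (label_of x)); last first.
  by case: x => [[e a] h]; rewrite ffunE /label_of /= sK.
by rewrite -relabel_paired (inj_eq injf).
Qed.

Lemma equivalent_replace (E F : finType) (sigma : E -> F) G H
    (p q : arrow_end E -> arrow_end E) (pK : cancel p q) (qK : cancel q p)
    (p' q' : arrow_end F -> arrow_end F) (pK' : cancel p' q') (qK' : cancel q' p')
    c r c' r' :
  bijective sigma -> nblank G = nblank H ->
  (forall x, relabel sigma c r (arc G x) = arc H (relabel sigma c r x)) ->
  (forall x, p' (relabel sigma c' r' x) = relabel sigma c r (p x)) ->
  equivalent sigma (replace_arrows pK qK G) (replace_arrows pK' qK' H).
Proof.
move=> bs eqb Hcr Hp; split=> //; split=> //; exists c', r' => x /=.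
by apply: (can_inj pK'); rewrite qK' !Hp qK Hcr.
Qed.

Lemma half_twist_equivalent (E F : finType) (sigma : E -> F) e a b G H :
  equivalent sigma G H ->
  equivalent sigma (half_twist_at e a G) (half_twist_at (sigma e) b H).
Proof.
case=> [bs [eqb [c [r Hcr]]]].
apply: (@equivalent_replace _ _ _ _ _ _ _ _ _ _ _ _ _ c r c
  (fun f => r f (+) ((f == e) && (a (+) c e != b))) bs eqb Hcr).
move=> [[f d] h]; rewrite /tau_place /arrow_of /= !xpair_eqE.
rewrite (inj_eq (bij_inj bs)); case: eqP => [->|_] /=; last by rewrite addbF.
by case: a; case: b; case: d; case Hc: (c e); case Hr: (r e); case: h;
  rewrite /= ?Hc ?Hr.
Qed.

Lemma partial_dual_equivalent (E F : finType) (sigma : E -> F) e G H :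
  equivalent sigma G H ->
  equivalent sigma (partial_dual e G) (partial_dual (sigma e) H).
Proof.
case=> [bs [eqb [c [r Hcr]]]].
apply: (@equivalent_replace _ _ _ _ _ _ _ _ _ _ _ _ _ c r
  (fun f => c f (+) ((f == e) && r e)) r bs eqb Hcr).
move=> [[f d] h] /=; rewrite (inj_eq (bij_inj bs)).
case: eqP => [->|_] /=; last by rewrite addbF.
by case: d; case Hc: (c e); case Hr: (r e); case: h; rewrite /= ?Hc ?Hr.
Qed.

(* Main.v *)
Require Import Defs.
From mathcomp Require Import all_boot all_order all_algebra.

(** Fix the vertex states away from [e], and let [Z t] be the sum of the
    contributions of the states equal to [t] at [e], the sign of [e] being
    left out.  Then [P(G) = Z white - Z crossing].  Changing the arrows
    labelled [e] only changes the way the four half-edges at [e] are paired: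
    the partial dual exchanges the white and black splits and fixes the
    crossing, the half-twist exchanges the white split and the crossing and
    fixes the black split.  All the polynomials of the theorem are thus
    differences of two of the three sums [Z t] of [G]. *)

Set Implicit Arguments.
Unset Strict Implicit.
Unset Printing Implicit Defensive.

Import GRing.Theory.

Local Open Scope ring_scope.

Section EdgeExpansion.
Variables (E : finType) (e : E).
Implicit Types (G : arrow_presentation E) (s : state E) (t : vertex_state).

(** [p] is a bijection carrying arcs to arcs and the pairings of [s] to those of [s'], hence curves
    to curves. *)
Lemma ncurves_replace (p q : arrow_end E -> arrow_end E)
    (pK : cancel p q) (qK : cancel q p) G s s' :
    (forall x, label_of (p x) = label_of x) ->
    (forall x, p (paired_with (s (label_of x)) x)
               = paired_with (s' (label_of x)) (p x)) ->
  ncurves (replace_arrows pK qK G) s = ncurves G s'.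
Proof.
move=> pl ps; rewrite /ncurves; apply: (f_equal (addn^~ (nblank G))).
apply: (@n_comp_bij _ _ p); [by exists q | | exact: curve_sym..].
move=> x y /=; rewrite pl -ps (inj_eq (can_inj pK)); congr orb.
by rewrite -[RHS](inj_eq (can_inj pK)) qK.
Qed.

Definition set_vertex_state s t : state E :=
  [ffun f => if f == e then t else s f].

(** A state away from [e] is encoded by its extension with a white split at [e], so [ncrossings s]
    ignores [e]. *)
Definition edge_sum G t : {poly int} :=
  \sum_(s : state E | penrose_state s && (s e == WhiteSplit))
    (-1) ^+ ncrossings s * 'X^(ncurves G (set_vertex_state s t)).

Lemma set_vertex_state_id s t : s e = t -> set_vertex_state s t = s.
Proof. by move=> <-; apply/ffunP=> f; rewrite ffunE; case: eqP => [->|]. Qed.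

Lemma set_vertex_stateK s t t' : s e = t ->
  set_vertex_state (set_vertex_state s t') t = s.
Proof. by move=> <-; apply/ffunP=> f; rewrite !ffunE; case: eqP => [->|]. Qed.

Lemma penrose_set_vertex_state s t :
  penrose_state s -> t <> BlackSplit -> penrose_state (set_vertex_state s t).
Proof.
by move=> /forallP ps /eqP tb; apply/forallP=> f; rewrite ffunE; case: ifP.
Qed.

Lemma ncrossings_set_crossing s : s e = WhiteSplit ->
  ncrossings (set_vertex_state s Crossing) = (ncrossings s).+1.
Proof.
move=> se; rewrite /ncrossings (cardsD1 e) inE ffunE !eqxx; congr _.+1.
apply: eq_card => f; rewrite !inE ffunE.
case: (eqVneq f e) => [->|//]; rewrite se /=.
by apply/esym/eqP.
Qed.

Lemma penrose_edge_sum G :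
  penrose G = edge_sum G WhiteSplit - edge_sum G Crossing.
Proof.
rewrite /penrose (bigID (fun s : state E => s e == WhiteSplit)) /=.
apply: (f_equal2 +%R).
  by apply: eq_bigr => s /andP[_ /eqP se]; rewrite set_vertex_state_id.
have notW s : penrose_state s -> s e != WhiteSplit -> s e = Crossing.
  by move=> /forallP /(_ e); case: (s e); rewrite ?eqxx.
rewrite (reindex_onto (fun s => set_vertex_state s Crossing)
                      (fun s => set_vertex_state s WhiteSplit)) /=; last first.
  by move=> s /andP[ps /(notW _ ps) se]; apply: set_vertex_stateK.
rewrite -sumrN; apply: eq_big => s.
  (* By [sK], resetting [e] to white gives [s] back, so [s] is white at [e]. *)
  apply/andP/andP=> [[/andP[ps _] /eqP sK]|[ps /eqP se]].
    rewrite -{1}sK penrose_set_vertex_state //; split=> //.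
    by rewrite -sK ffunE eqxx.
  rewrite penrose_set_vertex_state //; split; first by rewrite ffunE eqxx; apply/eqP.
  by rewrite set_vertex_stateK.
move=> /andP[_ /eqP sK]; rewrite ncrossings_set_crossing; last first.
  by rewrite -sK ffunE eqxx.
by rewrite exprS mulN1r mulNr.
Qed.

Lemma edge_sum_replace (p q : arrow_end E -> arrow_end E)
    (pK : cancel p q) (qK : cancel q p) G t t' :
    (forall x, label_of (p x) = label_of x) ->
    (forall x, label_of x != e -> p x = x) ->
    (forall a h, p (paired_with t ((e, a), h))
                 = paired_with t' (p ((e, a), h))) ->
  edge_sum (replace_arrows pK qK G) t = edge_sum G t'.
Proof.
move=> pl pid pe; apply: eq_bigr => s _.
rewrite (ncurves_replace _ _ _ (s' := set_vertex_state s t')) // => -[[f a] h]; rewrite !ffunE /label_of /=.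
case: (f =P e) => [->|/eqP fe]; first exact: pe.
by rewrite !pid ?label_paired.
Qed.

Definition swap_white_black t :=
  match t with
  | WhiteSplit => BlackSplit | BlackSplit => WhiteSplit | Crossing => Crossing
  end.

Definition swap_white_crossing t :=
  match t with
  | WhiteSplit => Crossing | BlackSplit => BlackSplit | Crossing => WhiteSplit
  end.

(** The new arrows lie along the two sides of the old edge disc: the cyclic order of the half-edges
    is kept, and black and white corners are exchanged. *)
Lemma edge_sum_partial_dual G t :
  edge_sum (partial_dual e G) t = edge_sum G (swap_white_black t).
Proof.
apply: edge_sum_replace => [[[f a] h]|[[f a] h]|a h].
- by rewrite /label_of /=; case: ifP; case: h.
- by rewrite /label_of /= => /negPf->.
by case: t; case: h; rewrite /paired_with /= ?eqxx ?black_cornerE /= ?eqxx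
  ?negbK.
Qed.

(** Exchanging the ends of one arrow keeps the pairing along arrows, and turns head-to-tail pairs
    into head-to-head and tail-to-tail ones. *)
Lemma edge_sum_half_twist G t :
  edge_sum (half_twist e G) t = edge_sum G (swap_white_crossing t).
Proof.
apply: edge_sum_replace => [x|[[f a] h]|a h].
- by rewrite /tau_place; case: ifP.
- by rewrite /tau_place /label_of /arrow_of /= xpair_eqE => /negPf->.
by case: t; case: a; case: h;
  rewrite /paired_with ?black_cornerE /tau_place /arrow_of /= ?xpair_eqE ?eqxx
    /= ?black_cornerE.
Qed.

End EdgeExpansion.

Theorem theorem5p2 (E : finType) (G : arrow_presentation E) (e : E) :
  penrose G = penrose (partial_dual e G)
              - penrose (partial_dual e (half_twist e G))
  /\
  penrose (partial_dual e G) - penrose (partial_dual e (half_twist e G))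
  = penrose (partial_dual e G)
    + penrose (partial_dual e (half_twist e (partial_dual e G))).
Proof.
(* With [W], [B], [C] the white, black and crossing sums of [G], the four polynomials are, in order
   of appearance, [W - C], [B - C], [B - W] and [W - B]. *)
rewrite !(penrose_edge_sum e) !(edge_sum_partial_dual, edge_sum_half_twist) /=.
split; last by rewrite opprB.
by rewrite opprB [RHS]addrC addrA subrK.
Qed.
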